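(* Let $K$ be a compact subset of $\mathbb{R}$ and let $\ell:\mathcal{C}(K)\to\mathbb{R}$ be a positive linear functional. Then there is a unique finite Borel measure $\mu$ such that $\mu(K)=\|\ell\|_{\mathcal{C}(K)^*}$ and $$\ell f=\int_K f\,d\mu\qquad\text{for every } f\in\mathcal{C}(K).$$
   Context: $\mathcal{C}(K)$ denotes the real vector space of continuous functions $f:K\to\mathbb{R}$, with the uniform norm $\|f\|_\infty=\sup\{|f(x)|:x\in K\}$. A functional $\ell:\mathcal{C}(K)\to\mathbb{R}$ is linear if $\ell(c_1f+c_2g)=c_1\ell(f)+c_2\ell(g)$ for all $f,g\in\mathcal{C}(K)$ and $c_1,c_2\in\mathbb{R}$, and positive if $\ell(f)\ge 0$ whenever $f(x)\ge 0$ for every $x\in K$. $\mathcal{C}(K)^*$ is the space of continuous linear functionals on $\mathcal{C}(K)$ (positive linear functionals are automatically continuous), with norm $\|\ell\|_{\mathcal{C}(K)^*}=\sup\{|\ell(f)|: f\in\mathcal{C}(K),\ \|f\|_\infty\le 1\}$. The Borel $\sigma$-algebra $\mathcal{B}_{\mathbb{R}}$ is the smallest $\sigma$-algebra of subsets of $\mathbb{R}$ containing all the open intervals; a Borel measure is a measure (a countably additive function with values in $[0,\infty]$ that vanishes on $\varnothing$) defined on $\mathcal{B}_{\mathbb{R}}$. The integral is the Lebesgue integral with respect to $\mu$.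
   Formalization: Uniqueness is stated for the values of the measure on Borel subsets of K (with a representing measure chosen to vanish off K), since a Borel measure on all of ℝ is not determined outside K by the two conditions. *)

(* Defs.v *)
From HB Require Import structures.
From mathcomp Require Export all_boot all_order all_algebra.
From mathcomp Require Export all_classical all_reals all_analysis.
Export Order.TTheory GRing.Theory Num.Theory.
Export numFieldNormedType.Exports.

Set Implicit Arguments.
Unset Strict Implicit.
Unset Printing Implicit Defensive.

Local Open Scope classical_set_scope.
Local Open Scope ring_scope.

Section ContinuousLmodule.
Context {R : realType} {X : topologicalType}.
Implicit Types (f g h : continuousType X R) (c : R).

Lemma ctsf_opp_subproof f : continuous (fun x => - f x).
Proof. by move=> x; exact: (cvgN (@cts_fun _ _ f x)). Qed.

Lemma ctsf_add_subproof f g : continuous (fun x => f x + g x).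
Proof. by move=> x; exact: (cvgD (@cts_fun _ _ f x) (@cts_fun _ _ g x)). Qed.

Lemma ctsf_scale_subproof c f : continuous (fun x => c * f x).
Proof. by move=> x; exact: (cvgM (cvg_cst c) (@cts_fun _ _ f x)). Qed.

Definition ctsf_zero : continuousType X R := cst (0 : R).
Definition ctsf_opp f : continuousType X R := mkcts (@ctsf_opp_subproof f).
Definition ctsf_add f g : continuousType X R := mkcts (@ctsf_add_subproof f g).
Definition ctsf_scale c f : continuousType X R :=
  mkcts (@ctsf_scale_subproof c f).

Lemma ctsf_addA : associative ctsf_add.
Proof. by move=> f g h; apply/continuousEP => x; exact: addrA. Qed.

Lemma ctsf_addC : commutative ctsf_add.
Proof. by move=> f g; apply/continuousEP => x; exact: addrC. Qed.

Lemma ctsf_add0 : left_id ctsf_zero ctsf_add.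
Proof. by move=> f; apply/continuousEP => x; exact: add0r. Qed.

Lemma ctsf_addN : left_inverse ctsf_zero ctsf_opp ctsf_add.
Proof. by move=> f; apply/continuousEP => x; exact: addNr. Qed.

HB.instance Definition _ := GRing.isZmodule.Build (continuousType X R)
  ctsf_addA ctsf_addC ctsf_add0 ctsf_addN.

Lemma ctsf_scaleA a b f : ctsf_scale a (ctsf_scale b f) = ctsf_scale (a * b) f.
Proof. by apply/continuousEP => x; exact: mulrA. Qed.

Lemma ctsf_scale1 : left_id 1 ctsf_scale.
Proof. by move=> f; apply/continuousEP => x; exact: mul1r. Qed.

Lemma ctsf_scaleDr : right_distributive ctsf_scale +%R.
Proof. by move=> c f g; apply/continuousEP => x; exact: mulrDr. Qed.

Lemma ctsf_scaleDl f : {morph ctsf_scale^~ f : a b / a + b}.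
Proof. by move=> a b; apply/continuousEP => x; exact: mulrDl. Qed.

HB.instance Definition _ :=
  GRing.Zmodule_isLmodule.Build R (continuousType X R)
    ctsf_scaleA ctsf_scale1 ctsf_scaleDr ctsf_scaleDl.

End ContinuousLmodule.

Section PositiveFunctional.
Context {R : realType} (K : set R).

(* A real supremum: meaningful for compact [K], and equal to 0 for [K] empty. *)
Definition uniform_norm (f : continuousType K R) : R :=
  sup (range (fun x => `|f x|)).

Definition dual_norm (l : {scalar continuousType K R}) : \bar R :=
  ereal_sup [set `|l f|%:E | f in [set f | uniform_norm f <= 1]].

Definition positive_functional (l : {scalar continuousType K R}) : Prop :=
  forall f : continuousType K R, (forall x, 0 <= f x) -> 0 <= l f.

(* ['valL_0 f] extends [f] by 0 outside [K]; the integral does not depend on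
   the extension. *)
Definition represents (mu : {finite_measure set (measurableTypeR R) -> \bar R})
    (l : {scalar continuousType K R}) : Prop :=
  mu K = dual_norm l /\
  forall f : continuousType K R,
    (l f)%:E = (\int[mu]_(x in K) ('valL_0 f x)%:E)%E.

End PositiveFunctional.

(* Main.v *)
Require Import Defs.
From HB Require Import structures.
From mathcomp Require Import measurable_realfun ring lra.

(** A positive functional l on C(K) is determined by a distribution function.
    Put F x = inf l(r), the infimum being over the continuous ramps r that
    are 1 up to some a > x and fall linearly to 0 (functional_cdf). Ramps are
    continuous substitutes for the indicator of ]-oo, x], so if l is the
    integral against a finite measure nu, then squeezing a ramp between two
    indicators and letting it steepen gives F x = nu (K `&` ]-oo, x])
    (functional_cdf_integral).

    Conversely F determines l (functional_cdf_inj). On a fine grid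
    x_0 < ... < x_N around K, a continuous g is uniformly close to its
    piecewise linear interpolation, which is a combination of ramps
    r_i = ramp x_i x_(i+1) with coefficients g(x_i) - g(x_(i+1)). Each l(r_i)
    lies between two values of F at nearby grid points. Two functionals with
    the same F therefore differ on r_i by at most an increment of F; these
    increments telescope to a bounded sum, and the coefficients of the r_i are
    uniformly small.

    For existence, F is nondecreasing and right-continuous, zero to the left
    of K and constant across every gap of K; hence its Lebesgue-Stieltjes
    measure gives no mass to the complement of K (stieltjes_setC0) and gives
    mass F x to K `&` ]-oo, x] (stieltjes_rayE). Integration against it over K
    is thus a positive functional with the same F as l, and so it is l. For
    uniqueness, any representing measure has the values F x on the rays
    K `&` ]-oo, x], hence its restriction to K agrees with the
    Lebesgue-Stieltjes measure of F on half-open intervals and so on all Borel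
    sets (stieltjes_unique). The identity mu K = dual_norm l holds because both
    sides equal l 1 (dual_norm_positive). *)

Set Implicit Arguments.
Unset Strict Implicit.
Unset Printing Implicit Defensive.

Local Open Scope classical_set_scope.
Local Open Scope ring_scope.

(** * Piecewise linear interpolation by ramps *)

Section Ramp.
Context {R : realType}.
Implicit Types a b t : R.

(** For [a < b] this is 1 up to [a], 0 from [b] on, and affine between. *)
Definition ramp a b t : R := Num.min 1 (Num.max 0 ((b - t) / (b - a))).

Lemma ramp_continuous a b : continuous (ramp a b).
Proof.
pose h t : R^o := (b - t) / (b - a).
have ch : continuous h.
  by move=> t; apply: cvgMr_tmp; apply: cvgB; [exact: cvg_cst|exact: cvg_id].
move=> t; have -> : ramp a b = (cst 1 : R -> R^o) \min (cst 0 \max h) by [].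
apply: continuous_min; first exact: cvg_cst.
by apply: continuous_max; [exact: cvg_cst|exact: ch].
Qed.

Lemma ramp_ge0 a b t : 0 <= ramp a b t.
Proof. by rewrite /ramp le_min ler01 le_max lexx. Qed.

Lemma ramp_le1 a b t : ramp a b t <= 1.
Proof. by rewrite /ramp ge_min lexx. Qed.

Lemma ramp1 a b t : a < b -> t <= a -> ramp a b t = 1.
Proof.
move=> ab ta; apply/min_idPl; rewrite le_max ler_pdivlMr ?subr_gt0// mul1r.
by rewrite lerB// orbT.
Qed.

Lemma ramp0 a b t : a < b -> b <= t -> ramp a b t = 0.
Proof.
move=> ab bt; rewrite /ramp; have /max_idPl -> : (b - t) / (b - a) <= 0.
  by rewrite ler_pdivrMr ?subr_gt0// mul0r subr_le0.
by apply/min_idPr.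
Qed.

(** The combination of ramps is the piecewise linear interpolation of [g] at
    the nodes: between two nodes it is a convex combination of the values of
    [g] at these nodes, so it inherits the oscillation bound. This form of the
    interpolation, with increments of [g] as coefficients, results from
    summation by parts and involves no hat functions. *)
Lemma ramp_interpolation (g : R -> R) (x : nat -> R) (e : R) (N : nat) :
    (forall i, x i < x i.+1) ->
    (forall i s t, x i <= s <= x i.+1 -> x i <= t <= x i.+1 ->
      (i < N)%N -> `|g s - g t| <= e) ->
    forall t, x 0%N <= t <= x N -> 0 <= e ->
  `|g t - (g (x N) +
      \sum_(i < N) (g (x i) - g (x i.+1)) * ramp (x i) (x i.+1) t)| <= e.
Proof.
move=> xS; elim: N => [|N IH] osc t /andP[x0t txN] e0.
  have -> : t = x 0%N by apply/eqP; rewrite eq_le txN.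
  by rewrite big_ord0 addr0 subrr normr0.
rewrite big_ord_recr/=; have [tN|Nt] := leP t (x N).
  (* Up to x N the new ramp is 1, and its coefficient turns the constant
     term g (x N.+1) back into g (x N). *)
  rewrite [ramp (x N) _ _]ramp1 ?mulr1//.
  rewrite [X in g t - X](_ : _ = g (x N) + \sum_(i < N)
    (g (x i) - g (x i.+1)) * ramp (x i) (x i.+1) t); last by ring.
  apply: IH => //; last by rewrite x0t.
  by move=> i s u si ui iN; apply: (osc i) => //; rewrite ltnS ltnW.
(* Beyond x N all earlier ramps vanish. *)
rewrite big1 ?add0r; last first.
  move=> i _; rewrite ramp0 ?mulr0//; apply: le_trans (ltW Nt).
  exact: (@nondecreasing_seqP _ _ x).1 (fun i => ltW (xS i)) _ _ (ltn_ord i).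
set r := ramp _ _ _.
rewrite (_ : _ - _ = (1 - r) * (g t - g (x N.+1)) + r * (g t - g (x N)));
  last by ring.
have r0 : 0 <= r := ramp_ge0 _ _ _.
have r1 : 0 <= 1 - r by rewrite subr_ge0 ramp_le1.
rewrite (le_trans (ler_normD _ _))// !normrM (ger0_norm r0) (ger0_norm r1).
have tI : x N <= t <= x N.+1 by rewrite ltW.
have := @osc N t (x N.+1) tI.
rewrite lexx (ltW (xS N)) => /(_ isT (leqnn _)) h1.
have := @osc N t (x N) tI.
rewrite lexx (ltW (xS N)) => /(_ isT (leqnn _)) h2.
have -> : e = (1 - r) * e + r * e by ring.
by apply: lerD; apply: ler_wpM2l.
Qed.

(** Heine's theorem, from compactness in the form of near coverings. *)
Lemma continuous_segment_unif (g : R -> R) (a b e : R) :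
    continuous g -> 0 < e ->
  exists2 d, 0 < d & forall s t, a <= t <= b -> `|t - s| <= d ->
    `|g t - g s| <= e.
Proof.
move=> cg e0.
have /compact_near_coveringP /near_covering_withinP := @segment_compact R a b.
move=> /(_ R (0^'+) (fun d t => forall s, `|t - s| <= d -> `|g t - g s| <= e)).
case=> [t0 _|d /= d0 dP].
- have e2 : 0 < e / 2 by rewrite divr_gt0.
  have /cvgrPdist_lt/(_ _ e2)[d /= d0 dP] := cg t0.
  have d2 : 0 < d / 2 by rewrite divr_gt0.
  exists (ball t0 (d / 2), [set u | 0 < u < d / 2]) => /=.
    split; first exact: nbhsx_ballx.
    exists (d / 2) => //= u; rewrite /ball_/= sub0r normrN => ud u0.
    by rewrite u0 (le_lt_trans (ler_norm _)).
  move=> [t u]/= [tt0 /andP[u0 ud]] _ s tsu.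
  have h1 : `|g t0 - g t| < e / 2.
    by apply: dP => /=; rewrite /ball/= in tt0 *; lra.
  have h2 : `|g t0 - g s| < e / 2.
    apply: dP; rewrite /ball/= in tt0 *; rewrite -(subrK t t0) -addrA.
    by rewrite (le_lt_trans (ler_normD _ _))//; lra.
  rewrite -(subrKA (g t0)) (le_trans (ler_normD _ _))// distrC.
  by rewrite (splitr e) lerD// ltW.
- exists (d / 2); first by rewrite divr_gt0.
  move=> s t abt tsd; apply: (dP (d / 2)) => //=.
  + rewrite sub0r normrN gtr0_norm ?divr_gt0// ltr_pdivrMr//; lra.
  + by rewrite divr_gt0.
Qed.

End Ramp.

(** * The distribution function of a positive functional *)

Section PositiveFunctionalTheory.
Context {R : realType} {K : set R}.
Local Notation C := (continuousType K R).
Implicit Types (l : {scalar C}) (f g : C).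

Definition one_cts : C := cst (1 : R).

Lemma sub_ctsE f g x : (f - g) x = f x - g x.
Proof. by []. Qed.

Lemma positive_functional_le l f g : positive_functional l ->
  (forall x, f x <= g x) -> l f <= l g.
Proof.
move=> lp fg; rewrite -subr_ge0 -raddfB; apply: lp => x.
by rewrite sub_ctsE subr_ge0.
Qed.

Lemma positive_functional_norm_le l f (M : R) : positive_functional l ->
  (forall x, `|f x| <= M) -> `|l f| <= M * l one_cts.
Proof.
move=> lp fM; rewrite -linearZ/= ler_norml -linearN/=; apply/andP; split.
  apply: positive_functional_le => // x.
  have -> : (- (M *: one_cts)) x = - (M * 1) by [].
  by rewrite mulr1; have := fM x; rewrite ler_norml => /andP[].
apply: positive_functional_le => // x.
have -> : (M *: one_cts) x = M * 1 by [].
by rewrite mulr1 (le_trans (ler_norm _)).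
Qed.

Lemma positive_functional1_ge0 l : positive_functional l -> 0 <= l one_cts.
Proof. by move=> lp; apply: lp => x; exact: ler01. Qed.

Lemma restr_continuous {g : R -> R} : continuous g -> continuous (sigL K g).
Proof.
by move=> cg; apply/subspace_sigL_continuousP; exact: continuous_subspaceT.
Qed.

Definition ramp_cts (a b : R) : C :=
  mkcts (@restr_continuous (ramp a b) (@ramp_continuous R a b)).

Lemma ramp_ctsE a b (x : K) : ramp_cts a b x = ramp a b (set_val x).
Proof. by []. Qed.

(** When [l] is integration against [nu] over [K], this is the function
    [x |-> nu (K `&` ]-oo, x])]. The ramps are required to be 1 strictly beyond
    [x], so that each of them also competes in the infimum at points slightly
    to the right of [x]: this is what makes the function right-continuous. *)
Definition functional_cdf l (x : R) : R :=
  inf [set l (ramp_cts p.1 p.2) | p in [set p : R * R | x < p.1 < p.2]].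

Lemma functional_cdf_has_inf l x : positive_functional l ->
  has_inf [set l (ramp_cts p.1 p.2) | p in [set p : R * R | x < p.1 < p.2]].
Proof.
move=> lp; split.
  exists (l (ramp_cts (x + 1) (x + 2))); exists (x + 1, x + 2) => //=.
  by apply/andP; split; lra.
by exists 0 => _ [p _ <-]; apply: lp => t; rewrite ramp_ctsE ramp_ge0.
Qed.

Lemma functional_cdf_le_ramp l x a b : positive_functional l -> x < a < b ->
  functional_cdf l x <= l (ramp_cts a b).
Proof.
move=> lp xab; apply: ge_inf; first exact: (functional_cdf_has_inf x lp).2.
by exists (a, b).
Qed.

Lemma le_functional_cdf l x c : positive_functional l ->
  (forall a b, x < a < b -> c <= l (ramp_cts a b)) -> c <= functional_cdf l x.
Proof.
move=> lp xc; apply: lb_le_inf; first exact: (functional_cdf_has_inf x lp).1.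
by move=> _ [p /= ? <-]; exact: xc.
Qed.

(** Together with [functional_cdf_le_ramp], this encloses [l] of a ramp between
    two values of the distribution function: every ramp competing at [b]
    dominates [ramp a b]. *)
Lemma ramp_le_functional_cdf l a b : positive_functional l -> a < b ->
  l (ramp_cts a b) <= functional_cdf l b.
Proof.
move=> lp ab; apply: le_functional_cdf => // c d /andP[bc cd].
apply: positive_functional_le => // x; rewrite !ramp_ctsE.
have [xc|cx] := leP (set_val x) c; first by rewrite (ramp1 cd)// ramp_le1.
by rewrite ramp0 ?ramp_ge0// (le_trans (ltW bc))// ltW.
Qed.

Lemma functional_cdf_nondecreasing l : positive_functional l ->
  nondecreasing (functional_cdf l).
Proof.
move=> lp x y xy; apply: le_functional_cdf => // a b /andP[ya ab].
by apply: functional_cdf_le_ramp => //; rewrite ab (le_lt_trans xy).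
Qed.

Lemma functional_cdf_right_continuous l : positive_functional l ->
  right_continuous (functional_cdf l).
Proof.
move=> lp x; apply/cvgrPdist_le => /= e e0.
have [_ [[a b]/= /andP[xa ab] <-] lte] :=
  inf_adherent e0 (functional_cdf_has_inf x lp).
near=> y; have xy : x < y by near: y; exact: nbhs_right_gt.
have ya : y < a by near: y; exact: nbhs_right_lt.
have Fxy := functional_cdf_nondecreasing lp (ltW xy).
rewrite distrC ger0_norm ?subr_ge0//.
rewrite lerBlDl; apply: le_trans (ltW lte).
by apply: functional_cdf_le_ramp; rewrite ?ya.
Unshelve. all: by end_near. Qed.

Lemma functional_cdf_eq0 l x : positive_functional l ->
  (exists2 y, x < y & forall t, K t -> y <= t) -> functional_cdf l x = 0.
Proof.
move=> lp [y xy Ky]; apply/eqP; rewrite eq_le; apply/andP; split; last first.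
  apply: le_functional_cdf => // a b _; apply: lp => t.
  by rewrite ramp_ctsE ramp_ge0.
pose a := (x + y) / 2.
have xay : x < a < y by rewrite /a; apply/andP; split; lra.
rewrite (le_trans (functional_cdf_le_ramp lp xay))//.
rewrite (_ : ramp_cts a y = 0) ?linear0//; apply/continuousEP => t.
by rewrite ramp_ctsE ramp0 ?(andP xay).2//; apply: Ky; exact: set_valP.
Qed.

Lemma functional_cdf_total l x : positive_functional l ->
  (forall t, K t -> t <= x) -> functional_cdf l x = l one_cts.
Proof.
move=> lp Kx.
have r1 a b : x <= a -> a < b -> ramp_cts a b = one_cts.
  move=> xa ab; apply/continuousEP => t; rewrite ramp_ctsE ramp1//.
  by apply: le_trans xa; apply: Kx; exact: set_valP.
apply/eqP; rewrite eq_le; apply/andP; split.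
  rewrite (le_trans (functional_cdf_le_ramp lp (_ : x < x + 1 < x + 2)))//.
    by apply/andP; split; lra.
  by rewrite r1//; lra.
by apply: le_functional_cdf => // a b /andP[xa ab]; rewrite r1// ltW.
Qed.

Lemma functional_cdf_ge0 l x : positive_functional l -> 0 <= functional_cdf l x.
Proof.
move=> lp; apply: le_functional_cdf => // a b _; apply: lp => t.
by rewrite ramp_ctsE ramp_ge0.
Qed.

Lemma functional_cdf_le_total l x : positive_functional l ->
  functional_cdf l x <= l one_cts.
Proof.
move=> lp; have xI : x < x + 1 < x + 2 by apply/andP; split; lra.
rewrite (le_trans (functional_cdf_le_ramp lp xI))//.
by apply: positive_functional_le => // t; rewrite ramp_ctsE ramp_le1.
Qed.

(** On [K], a ramp that starts and ends inside the gap lies below every ramp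
    that starts to the right of [x]. *)
Lemma functional_cdf_gap l a b x y : positive_functional l ->
  (forall t, K t -> t <= a \/ b <= t) -> a <= x -> x <= y -> y < b ->
  functional_cdf l y = functional_cdf l x.
Proof.
move=> lp gap ax xy yb; apply/eqP.
rewrite eq_le (functional_cdf_nondecreasing lp xy) andbT.
apply: le_functional_cdf => // c d /andP[xc cd].
pose z := (y + b) / 2.
have yzb : y < z < b by rewrite /z; apply/andP; split; lra.
rewrite (le_trans (functional_cdf_le_ramp lp yzb))//.
apply: positive_functional_le => // t; rewrite !ramp_ctsE.
have [ta|bt] := gap _ (set_valP t).
  by rewrite (ramp1 cd) ?ramp_le1// (le_trans ta)// ltW// (le_lt_trans ax).
by rewrite ramp0 ?ramp_ge0 ?(andP yzb).2.
Qed.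

(** The margin at the left end makes the distribution function vanish
    at [a]. *)
Lemma compact_segment : compact K ->
  exists a b : R, a < b /\ forall t, K t -> a + 1 <= t <= b.
Proof.
move=> /compact_bounded[M [_ MP]].
exists (- (`|M| + 2)), (`|M| + 2); split; first by have := normr_ge0 M; lra.
move=> t Kt; have M1 : M < `|M| + 1.
  by rewrite (le_lt_trans (ler_norm _))//; lra.
have := MP _ M1 t Kt; rewrite /= ler_norml => /andP[? ?].
by apply/andP; split; lra.
Qed.

(** Tietze's theorem; it gives a meaning to the values of [f] at grid points
    that fall into gaps of [K]. *)
Lemma continuous_compact_extension f : compact K ->
  exists2 g : R -> R, continuous g & forall x : K, f x = g (set_val x).
Proof.
move=> cK.
have cf : {within K, continuous ('valL_(0:R) f : R -> R^o)}.
  by apply/subspace_valL_continuousP'; exact: cts_fun.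
have clK : closed K by apply: compact_closed => //; exact: Rhausdorff.
have [M [_ MP]] := compact_bounded (continuous_compact cf cK).
have M0 : 0 < `|M| + 1 by have := normr_ge0 M; lra.
have bf x : K x -> `|'valL_(0:R) f x| <= `|M| + 1.
  move=> Kx; apply: (MP (`|M| + 1)); last by exists x.
  by rewrite (le_lt_trans (ler_norm _))//; lra.
have [g [fg cg _]] := continuous_bounded_extension
  (@pseudometric_normal R R) clK M0 cf bf.
exists g => // x; rewrite -fg; last exact/mem_set/set_valP.
by have /(congr1 (@^~ x)) := @valLK _ _ (0 : R) K f.
Qed.

(** A positive functional can be recovered from its distribution function.
    Both functionals change little when [f] is replaced by its interpolation
    [p] by ramps. On the ramp from [x i] to [x i.+1] both take values between
    [F (x i - h)] and [F (x i.+1)], where [h] is the mesh. The sum of these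
    differences telescopes, so [l1 p] and [l2 p] differ by at most the
    oscillation [e] of the function between nodes times twice the total mass
    [l1 1]. *)
Lemma functional_cdf_inj l1 l2 : compact K ->
  positive_functional l1 -> positive_functional l2 ->
  functional_cdf l1 =1 functional_cdf l2 -> l1 =1 l2.
Proof.
move=> cK l1p l2p eqF f.
have [a [b [ab Kab]]] := compact_segment cK.
have [g cg fg] := continuous_compact_extension f cK.
have l1E : l1 one_cts = l2 one_cts.
  by rewrite -!(@functional_cdf_total _ b)// => t /Kab/andP[].
set F := functional_cdf l1; pose c := l1 one_cts.
have c0 : 0 <= c := positive_functional1_ge0 l1p.
(* The factor is 2 c for the ramps plus c for each of l1 (f - p), l2 (f - p);
   the summand 1 only keeps it positive. *)
suff H e : 0 < e -> `|l1 f - l2 f| <= e * (4 * c + 1).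
  apply/eqP; rewrite -subr_eq0 -normr_le0; apply/ler_addgt0Pr => e e0.
  have c1 : 0 < 4 * c + 1 by lra.
  rewrite add0r; have := H (e / (4 * c + 1)).
  by rewrite divfK ?gt_eqF//; apply; exact: divr_gt0.
move=> e0; have [d d0 gd] := @continuous_segment_unif R g a b e cg e0.
have [N Nd] : exists N : nat, (b - a) / N.+1%:R <= d.
  exists (Num.bound ((b - a) / d)).
  have bd : (b - a) / d < (Num.bound ((b - a) / d))%:R.
    by rewrite archi_boundP// divr_ge0// ?subr_ge0 ltW.
  rewrite ler_pdivrMr// mulrC -ler_pdivrMr// ltW// (lt_le_trans bd)//.
  by rewrite ler_nat.
pose h := (b - a) / N.+1%:R.
have h0 : 0 < h by rewrite divr_gt0// subr_gt0.
pose x (i : nat) := a + i%:R * h.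
have xSE i : x i.+1 = x i + h by rewrite /x -natr1; ring.
have xS i : x i < x i.+1 by rewrite xSE ltrDl.
have xN : x N.+1 = b by rewrite /x /h mulrC divfK ?pnatr_eq0//; ring.
have x0 : x 0%N = a by rewrite /x mul0r addr0.
have xab i : (i <= N.+1)%N -> a <= x i <= b.
  move=> iN; rewrite -x0 -xN.
  by apply/andP; split; apply: (nondecreasing_seqP x).1 => // k; exact: ltW.
have osc i s t : x i <= s <= x i.+1 -> x i <= t <= x i.+1 ->
    (i < N.+1)%N -> `|g s - g t| <= e.
  move=> /andP[s0 s1] /andP[t0 t1] iN; apply: gd.
    have /andP[? _] := xab _ (ltnW iN); have /andP[_ ?] := xab _ iN.
    by apply/andP; split; lra.
  by rewrite (le_trans _ Nd)// -/h ler_norml; move: s1 t1; rewrite xSE; lra.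
pose p : C := g b *: one_cts +
  \sum_(i < N.+1) (g (x i) - g (x i.+1)) *: ramp_cts (x i) (x i.+1).
have pE t : p t = g b + \sum_(i < N.+1)
    (g (x i) - g (x i.+1)) * ramp (x i) (x i.+1) (set_val t).
  have -> : p t = g b * 1 + (\sum_(i < N.+1)
    (g (x i) - g (x i.+1)) *: ramp_cts (x i) (x i.+1)) t by [].
  rewrite mulr1; congr (_ + _).
  by elim/big_rec2 : _ => // i y u _ <-.
have fp t : `|(f - p) t| <= e.
  rewrite sub_ctsE pE fg -xN; apply: ramp_interpolation => //.
    rewrite x0 xN; have /andP[at_ ->] := Kab _ (set_valP t).
    by rewrite (le_trans _ at_)// lerDl.
  exact: ltW.
have Dp : `|l1 p - l2 p| <= e * (2 * c).
  have lpE l : l p = g b * l one_cts + \sum_(i < N.+1)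
      (g (x i) - g (x i.+1)) * l (ramp_cts (x i) (x i.+1)).
    rewrite /p linearD linearZ linear_sum/=; congr (_ + _).
    by apply: eq_bigr => i _; rewrite linearZ.
  rewrite !lpE l1E opprD addrACA subrr add0r -sumrB.
  under eq_bigr do rewrite -mulrBr.
  rewrite (le_trans (ler_norm_sum _ _ _))//.
  (* The increments F (x i.+1) - F (x i - h) overlap pairwise; as
     x i = x i.+1 - h, they are the increments of this G. *)
  pose G (i : nat) := F (x i) + F (x i - h).
  apply: (@le_trans _ _ (\sum_(i < N.+1) e * (G i.+1 - G i))).
    apply: ler_sum => i _; rewrite normrM; apply: ler_pM => //.
      by apply: (osc i); rewrite ?lexx ?(ltW (xS _)).
    have xh : x i - h < x i < x i.+1 by rewrite xS andbT; lra.
    have := functional_cdf_le_ramp l1p xh.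
    have := functional_cdf_le_ramp l2p xh.
    have := ramp_le_functional_cdf l1p (xS i).
    have := ramp_le_functional_cdf l2p (xS i).
    rewrite -!eqF -/F /G xSE addrK ler_norml => *; apply/andP; split; lra.
  rewrite -mulr_sumr ler_wpM2l ?(ltW e0)//.
  rewrite -(big_mkord xpredT (fun i => G i.+1 - G i)) telescope_sumr//.
  have := functional_cdf_le_total (x N.+1) l1p.
  have := functional_cdf_le_total (x N.+1 - h) l1p.
  have := functional_cdf_ge0 (x 0%N) l1p.
  have := functional_cdf_ge0 (x 0%N - h) l1p.
  by rewrite -/F -/c /G; lra.
have := positive_functional_norm_le l1p fp.
have := positive_functional_norm_le l2p fp.
rewrite -l1E -/c !linearB/= !ler_norml => /andP[? ?] /andP[? ?].
by move: Dp; rewrite !ler_norml => /andP[? ?]; apply/andP; split; lra.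
Qed.

End PositiveFunctionalTheory.

(** * Integration of C(K) against a finite measure *)

Section Integration.
Context {R : realType} {K : set R} (cK : compact K).
Local Notation C := (continuousType K R).
Implicit Types f g : C.
Implicit Types nu : {finite_measure set (measurableTypeR R) -> \bar R}.

Lemma valL_ctsE f (x : K) : 'valL_(0 : R) f (set_val x) = f x.
Proof. by have /(congr1 (@^~ x)) := @valLK _ _ (0 : R) K f. Qed.

Lemma valL_ramp_cts a b t : K t ->
  'valL_(0 : R) (ramp_cts a b : C) t = ramp a b t.
Proof.
move=> Kt; exact: (valL_ctsE (ramp_cts a b) (SigSub (mem_set Kt))).
Qed.

Lemma measurable_valL_cts f : measurable_fun K ('valL_(0 : R) f).
Proof.
apply: subspace_continuous_measurable_fun; first exact: compact_measurable.
by apply/subspace_valL_continuousP'; exact: cts_fun.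
Qed.

Lemma valL_cts_bounded f : exists2 M, 0 <= M & forall t, K t ->
  `|'valL_(0 : R) f t| <= M.
Proof.
have [g cg fg] := continuous_compact_extension f cK.
have cgK : {within K, continuous (g : R -> R^o)} by exact: continuous_subspaceT.
have [M [_ MP]] := compact_bounded (continuous_compact cgK cK).
exists (`|M| + 1) => [|t Kt]; first by rewrite addr_ge0.
rewrite (valL_ctsE f (SigSub (mem_set Kt))) fg; apply: (MP (`|M| + 1)).
  by rewrite (le_lt_trans (ler_norm _))//; lra.
by exists t.
Qed.

Lemma integrable_valL_cts nu f : nu.-integrable K (EFin \o 'valL_(0 : R) f).
Proof.
apply: measurable_bounded_integrable.
- exact: compact_measurable.
- by rewrite ltey_eq fin_num_measure//; exact: compact_measurable.
- exact: measurable_valL_cts.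
- have [M M0 fM] := valL_cts_bounded f.
  exists M; split; first exact: ger0_real.
  by move=> N MN t /fM/le_trans; apply; exact: ltW.
Qed.

(** Packages integration as a bundled positive functional, so that
    [functional_cdf_inj] applies to it. *)
Lemma integral_functional_exists nu : exists l : {scalar C},
  positive_functional l /\ forall f, l f = \int[nu]_(x in K) 'valL_(0 : R) f x.
Proof.
pose phi (f : C) : R := \int[nu]_(x in K) 'valL_(0 : R) f x.
have mK : measurable (K : set (measurableTypeR R)) by exact: compact_measurable.
have phi_lin : linear_for *%R phi.
  move=> c f g; rewrite /phi -(RintegralZl c mK (integrable_valL_cts nu f)).
  rewrite -RintegralD//; last 2 first.
  - by apply: eq_integrable (integrableZl mK c (integrable_valL_cts nu f)).
  - exact: integrable_valL_cts.
  apply: eq_Rintegral => t /set_mem Kt.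
  by rewrite !(valL_ctsE _ (SigSub (mem_set Kt))).
pose L := GRing.isLinear.Build R C R *%R phi phi_lin.
exists (HB.pack phi L : {scalar C}); split => // f f0.
apply: Rintegral_ge0 => t Kt.
by rewrite (valL_ctsE f (SigSub (mem_set Kt))).
Qed.

(** A ramp that falls from 1 to 0 inside [ ]x, x + 1/n] ] lies between the
    indicators of [ ]-oo, x] ] and [ ]-oo, x + 1/n] ]; the measures of these
    two rays have the same limit by continuity from above. *)
Lemma functional_cdf_integral nu (l : {scalar C}) x : positive_functional l ->
  (forall f, (l f)%:E = (\int[nu]_(x in K) ('valL_(0 : R) f x)%:E)%E) ->
  (functional_cdf l x)%:E = nu (K `&` `]-oo, x]).
Proof.
move=> lp lE.
have mK : measurable (K : set (measurableTypeR R)) by exact: compact_measurable.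
have mKx y : measurable (K `&` `]-oo, y] : set (measurableTypeR R)).
  by apply: measurableI => //; exact: measurable_itv.
have mI y : measurable (`]-oo, y]%classic : set (measurableTypeR R)).
  exact: measurable_itv.
have nuE y : nu (K `&` `]-oo, y]) =
    (\int[nu]_(t in K) (\1_(`]-oo, y]%classic) t)%:E)%E.
  by rewrite integral_indic// setIC.
have mind y : measurable_fun (K : set (measurableTypeR R))
    (fun t => (\1_(`]-oo, y]%classic) t : R)%:E).
  by apply/measurable_EFinP; exact: measurable_indic.
have mr a b : measurable_fun (K : set (measurableTypeR R))
   (fun t => ('valL_(0 : R) (ramp_cts a b : C) t)%:E).
  by apply/measurable_EFinP; exact: measurable_valL_cts.
apply/eqP; rewrite eq_le; apply/andP; split; last first.
  rewrite -(@fineK _ (nu _)) ?fin_num_measure// lee_fin.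
  apply: le_functional_cdf => // a b /andP[xa ab].
  rewrite -lee_fin fineK ?fin_num_measure// lE nuE.
  apply: ge0_le_integral => // t Kt; rewrite ?valL_ramp_cts//.
  rewrite lee_fin indicE.
  case: (boolP (t \in _)) => [/set_mem|_]; last exact: ramp_ge0.
  rewrite /= in_itv/= => tx; rewrite ramp1//; exact: le_trans (ltW xa).
have ub n : ((functional_cdf l x)%:E <=
    nu (K `&` `]-oo, (x + n.+1%:R^-1)%R]))%E.
  have n0 : 0 < n.+1%:R^-1 :> R by rewrite invr_gt0.
  move: (n.+1%:R^-1) n0 => e e0; set b := x + e.
  have xab : x < (x + b) / 2 < b by rewrite /b; apply/andP; split; lra.
  apply: (@le_trans _ _ (l (ramp_cts ((x + b) / 2) b))%:E).
    by rewrite lee_fin; exact: functional_cdf_le_ramp.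
  rewrite lE nuE; apply: ge0_le_integral => // t Kt; rewrite ?valL_ramp_cts//.
    by rewrite lee_fin ramp_ge0.
  rewrite lee_fin indicE.
  case: (boolP (t \in _)) => [_|]; first exact: ramp_le1.
  rewrite notin_setE/= in_itv/= => /negP; rewrite -ltNge => bt.
  by rewrite ramp0//; [exact: (andP xab).2|exact: ltW].
pose A n : set (measurableTypeR R) := K `&` `]-oo, (x + n.+1%:R^-1)%R].
have capA : \bigcap_n A n = K `&` `]-oo, x].
  by rewrite (itvNycEbigcap false) /A bigcapIr//; exists 0%N.
have cvgA : (nu \o A) n @[n --> \oo] --> nu (K `&` `]-oo, x]).
  rewrite -capA; apply: nonincreasing_cvg_mu => //.
  - by rewrite ltey_eq fin_num_measure//; exact: mKx.
  - by move=> n; exact: mKx.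
  - by rewrite capA; exact: mKx.
  - move=> m n mn; apply/subsetPset; apply: setIS; apply: subset_itvl.
    by rewrite bnd_simp lerD2l lef_pV2 ?posrE// ler_nat.
rewrite -(cvg_lim _ cvgA)//; apply: lime_ge.
  by apply/cvg_ex; eexists; exact: cvgA.
by apply: nearW => n; exact: ub.
Qed.

End Integration.

(** * The norm of a positive functional *)

(** The norm of a positive functional is attained at the constant 1, because
    [|f| <= 1] implies [|l f| <= l 1]. When [K] is empty, the uniform norm of 1
    is [sup set0 = 0], which is still at most 1. *)
Lemma dual_norm_positive {R : realType} {K : set R}
    (l : {scalar continuousType K R}) :
  compact K -> positive_functional l -> dual_norm l = (l one_cts)%:E.
Proof.
move=> cK lp; have l1 := positive_functional1_ge0 lp.
apply/eqP; rewrite eq_le; apply/andP; split.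
  apply: ge_ereal_sup => _ [f /= f1 <-]; rewrite lee_fin -[leRHS]mul1r.
  apply: positive_functional_norm_le => // x; apply: le_trans f1.
  apply: ub_le_sup; last by exists x.
  have [M _ fM] := valL_cts_bounded cK f.
  by exists M => _ [y _ <-]; rewrite -valL_ctsE; apply: fM; exact: set_valP.
apply: ereal_sup_ubound; exists one_cts => /=; last by rewrite ger0_norm.
have [x|K0] := pselect (exists x : K, True).
  apply: ge_sup; first by case: x => x _; exists `|one_cts x|, x.
  by move=> _ [y _ <-]; rewrite normr1.
have r0 : range (fun x : K => `|one_cts x|) = set0.
  by apply/seteqP; split => // _ [y _ <-]; case: K0; exists y.
by rewrite /uniform_norm r0 sup0 ler01.
Qed.

(** * The Lebesgue-Stieltjes measure of the distribution function *)

Lemma lebesgue_stieltjes_measure_ocitv {R : realType} (F : cumulative R R)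
    (a b : R) :
  a <= b -> lebesgue_stieltjes_measure F `]a, b] = (F b - F a)%:E.
Proof.
move=> ab; rewrite /lebesgue_stieltjes_measure /measure_extension.
by rewrite measurable_mu_extE/= ?wlength_itv_bnd//; exact: is_ocitv.
Qed.

Section StieltjesMeasure.
Context {R : realType} {K : set R} (cK : compact K).
Context (l : {scalar continuousType K R}) (lp : positive_functional l).

(** Carrying the positivity proof in the term lets the cumulative structure be
    inferred from it. *)
Definition positive_cdf (_ : positive_functional l) : R -> R :=
  functional_cdf l.

HB.instance Definition _ := isCumulative.Build R _ R (positive_cdf lp)
  (functional_cdf_nondecreasing lp) (functional_cdf_right_continuous lp).

Let mu : {measure set (measurableTypeR R) -> \bar R} :=
  lebesgue_stieltjes_measure (positive_cdf lp).

Let mK : measurable (K : set (measurableTypeR R)).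
Proof. exact: compact_measurable. Qed.

Lemma stieltjes_ocitv a b : a <= b ->
  mu `]a, b]%classic = (functional_cdf l b - functional_cdf l a)%:E.
Proof. exact: lebesgue_stieltjes_measure_ocitv. Qed.

(** The interval is the union of the [ ]a, c] ] with [c < b], and their measures
    are increments of the distribution function inside the gap. *)
Lemma stieltjes_gap0 a b : (forall t, K t -> t <= a \/ b <= t) ->
  mu `]a, b[%classic = 0%E.
Proof.
move=> gap.
have m (i : interval R) : measurable ([set` i] : set (measurableTypeR R)).
  exact: measurable_itv.
apply/negligibleP => //; rewrite itv_bnd_open_bigcup.
apply: negligible_bigcup => n; apply/negligibleP => //.
have [ac|ca] := leP a (b - n.+1%:R^-1); last first.
  by rewrite set_itv_ge ?measure0// bnd_simp -leNgt ltW.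
apply: etrans (stieltjes_ocitv ac) _.
have cb : b - n.+1%:R^-1 < b by rewrite ltrBlDr ltrDl invr_gt0 ltr0n.
by rewrite (functional_cdf_gap lp gap (lexx a) ac cb) subrr.
Qed.

(** The open set [~` K] is a countable union of rational balls, each of which
    is a gap of [K]. *)
Lemma stieltjes_setC0 : mu (~` K) = 0%E.
Proof.
have oK : open (~` K).
  by apply: closed_openC; apply: compact_closed => //; exact: Rhausdorff.
pose B (p : rat * rat) : set R := ball (ratr p.1 : R) (ratr p.2).
pose G p : set (measurableTypeR R) := [set t | B p `<=` ~` K /\ B p t].
pose F n : set (measurableTypeR R) := oapp G set0 (unpickle n).
apply/negligibleP; first exact: measurableC.
apply: (@negligibleS _ _ _ _ (\bigcup_n F n)).
  move=> x /mem_set/(open_subball_rat oK)[c [r [/set_mem xB BK]]].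
  exists (pickle (c, r)); first exact: Logic.I.
  have -> : F (pickle (c, r)) = B (c, r).
    by rewrite /F pickleK; apply/seteqP; split => [y []|y yB] //; split.
  exact: xB.
apply: negligible_bigcup => n; rewrite /F.
case: (unpickle n) => [p|]; last exact: negligible_set0.
have [BK|nBK] := pselect (B p `<=` ~` K); last first.
  have G0 : G p `<=` set0 by move=> t [].
  exact: (negligibleS G0 (negligible_set0 mu)).
have GB : G p `<=` B p by move=> t [].
apply: (negligibleS GB).
apply/negligibleP; rewrite /B ball_itv; first exact: measurable_itv.
apply: stieltjes_gap0 => t Kt; apply: contrapT => /not_orP[/negP + /negP].
rewrite -!ltNge => h1 h2; apply: (BK t) => //.
by rewrite /B ball_itv/= in_itv/= h1.
Qed.

(** If [a] lies strictly to the left of [K], then [ ]a, x] ] differs from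
    [K `&` ]-oo, x] ] by a part of the null set [~` K], and the distribution
    function vanishes at [a]. *)
Lemma stieltjes_rayE x : mu (K `&` `]-oo, x]) = (functional_cdf l x)%:E.
Proof.
have [a [b [ab Kab]]] := compact_segment cK.
have [xa|ax] := ltP x a.
  rewrite (functional_cdf_eq0 lp); last first.
    exists a => // t /Kab/andP[+ _]; apply: le_trans; lra.
  rewrite (_ : _ `&` _ = set0) ?measure0//; apply/seteqP; split => // t [].
  by move=> /Kab/andP[+ _]; rewrite /= in_itv/=; lra.
have Fa : functional_cdf l a = 0.
  apply: (functional_cdf_eq0 lp); exists (a + 1); first by rewrite ltrDl.
  by move=> t /Kab/andP[].
have mKx : measurable (K `&` `]-oo, x] : set (measurableTypeR R)).
  by apply: measurableI => //; exact: measurable_itv.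
have max : measurable (`]a, x]%classic : set (measurableTypeR R)).
  exact: measurable_itv.
have <- : mu `]a, x]%classic = (functional_cdf l x)%:E.
  by apply: etrans (stieltjes_ocitv ax) _; rewrite Fa subr0.
apply/eqP; rewrite eq_le; apply/andP; split.
  apply: le_measure; rewrite ?inE// => t [/Kab/andP[+ _]].
  rewrite /= !in_itv/= => + ->; rewrite andbT.
  by apply: lt_le_trans; rewrite ltrDl.
apply: (@le_trans _ _ (mu ((K `&` `]-oo, x]) `|` ~` K))).
  apply: le_measure; rewrite ?inE//.
    by apply: measurableU => //; exact: measurableC.
  move=> t /=; rewrite !in_itv/= => /andP[_ ->].
  by have [Kt|Kt] := pselect (K t); [left|right].
apply: (@le_trans _ _ (mu (K `&` `]-oo, x]) + mu (~` K))%E).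
  by apply: measureU2 => //; exact: measurableC.
by rewrite stieltjes_setC0 adde0.
Qed.

Lemma stieltjes_finite : (mu K < +oo)%E.
Proof.
have [a [b [ab Kab]]] := compact_segment cK.
rewrite (_ : K = K `&` `]-oo, b]) ?stieltjes_rayE ?ltry//.
by apply/esym/setIidl => t /Kab/andP[_]; rewrite /= in_itv.
Qed.

(** The values on the rays [K `&` ]-oo, x] ] give by subtraction those of the
    restriction of [nu] to [K] on half-open intervals, and these determine a
    Borel measure that is finite on bounded intervals. *)
Lemma stieltjes_unique
    (nu : {finite_measure set (measurableTypeR R) -> \bar R}) :
  (forall x, nu (K `&` `]-oo, x]) = (functional_cdf l x)%:E) ->
  forall A : set (measurableTypeR R), measurable A -> mu A = nu (A `&` K).
Proof.
move=> nuE A mA; rewrite -[RHS]/(mrestr nu mK A).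
apply: lebesgue_stieltjes_measure_unique => // _ [[c d] _ <-].
have [cd|dc] := leP c d; last first.
  by rewrite set_itv_ge ?measure0// bnd_simp -leNgt ltW.
apply: etrans (stieltjes_ocitv cd) _; rewrite /mrestr.
have mI (i : interval R) :
    measurable (K `&` [set` i] : set (measurableTypeR R)).
  by apply: measurableI => //; exact: measurable_itv.
have : nu (K `&` `]-oo, d]) = (nu (K `&` `]-oo, c]) + nu (K `&` `]c, d]))%E.
  rewrite -measureU//; last first.
    rewrite setIACA (_ : `]-oo, c]%classic `&` `]c, d]%classic = set0) ?setI0//.
    by apply/seteqP; split => // t []/=; rewrite !in_itv/= => ? /andP[]; lra.
  rewrite -setIUr; congr (nu (_ `&` _)).
  by rewrite -itv_bndbnd_setU.
rewrite !nuE setIC => dE; rewrite EFinB dE addeAC subee ?add0e//.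
Qed.

End StieltjesMeasure.

(** * The representation theorem *)

Theorem theorem3p1 (R : realType) (K : set R) (l : {scalar continuousType K R}) :
  compact K -> positive_functional l ->
  exists mu : {finite_measure set (measurableTypeR R) -> \bar R},
    [/\ mu (~` K) = 0%E,
        represents mu l &
        forall nu : {finite_measure set (measurableTypeR R) -> \bar R},
          represents nu l ->
          forall A : set (measurableTypeR R),
            measurable A -> A `<=` K -> nu A = mu A].
Proof.
move=> cK lp.
have mK : measurable (K : set (measurableTypeR R)) by exact: compact_measurable.
pose mu : {finite_measure set (measurableTypeR R) -> \bar R} :=
  mfrestr mK (stieltjes_finite cK lp).
have muE A : mu A = lebesgue_stieltjes_measure (positive_cdf lp) (A `&` K).
  by [].
have mu_ray x : mu (K `&` `]-oo, x]) = (functional_cdf l x)%:E.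
  by rewrite muE setIAC setIid stieltjes_rayE.
(* Integration against mu is a positive functional l' with the same
   distribution function as l. *)
have lE f : (l f)%:E = (\int[mu]_(x in K) ('valL_0 f x)%:E)%E.
  have [l' [l'p l'E]] := integral_functional_exists cK mu.
  have l'I g : (l' g)%:E = (\int[mu]_(x in K) ('valL_0 g x)%:E)%E.
    rewrite l'E /Rintegral fineK//.
    exact: (integrable_fin_num mK (integrable_valL_cts cK mu g)).
  rewrite -l'I; congr (_%:E); apply: (functional_cdf_inj cK lp l'p) => x.
  by apply: EFin_inj; rewrite (functional_cdf_integral cK x l'p l'I) mu_ray.
exists mu; split.
- by rewrite muE setICl measure0.
- split => //; rewrite (dual_norm_positive cK lp) lE.
  rewrite (eq_integral (cst 1%E)); last first.
    by move=> t /set_mem Kt; rewrite (valL_ctsE one_cts (SigSub (mem_set Kt))).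
  by rewrite integral_cst// mul1e.
- move=> nu [_ nuE] A mA AK.
  have nu_ray x : nu (K `&` `]-oo, x]) = (functional_cdf l x)%:E.
    by rewrite (functional_cdf_integral cK x lp nuE).
  rewrite muE (setIidl AK) (stieltjes_unique cK lp nu_ray mA).
  by rewrite (setIidl AK).
Qed.
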